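(* There is a universal constant $C>0$ such that the following holds. Let $n\ge 2$ and $T\ge 1$ be integers, and consider any sequence of $T$ requests on the vertex set $[n]$, where the $t$-th request is an edge $\{i_t,j_t\}$ (with $i_t\ne j_t$) with weight $w_t\in[0,1]$. If the discrepancy vectors $d_0,d_1,\ldots,d_T\in\mathbb{R}^n$ are produced by the Greedy algorithm starting from $d_0=0$, then $$\max_{t\le T}\|d_t\|_\infty\le C\,\min\{T^{1/3},\,n\}.$$
   Context: Online carpooling problem (discrepancy formulation): at each time $t=1,2,\ldots,T$ a request arrives, consisting of two distinct vertices $i_t,j_t\in[n]$ and a weight $w_t\in[0,1]$. The algorithm must immediately and irrevocably choose a sign $\epsilon_t\in\{-1,1\}$ (an orientation of the edge), and the discrepancy vector is updated as $d_t=d_{t-1}+\epsilon_t w_t(\mathbf{1}(i_t)-\mathbf{1}(j_t))$, where $\mathbf{1}(i)$ denotes the $i$-th standard basis vector and $d_0=0$. Greedy algorithm: at time $t$, labelling the two requested vertices as $i,j$ so that $d_{t-1}(i)\le d_{t-1}(j)$ (ties broken arbitrarily), Greedy sets $d_t(i)=d_{t-1}(i)+w_t$ and $d_t(j)=d_{t-1}(j)-w_t$; all other coordinates are unchanged. *)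

(* Defs.v *)
From HB Require Import structures.
From mathcomp Require Import all_boot all_order all_algebra.
From mathcomp Require Import all_classical all_reals all_analysis.
Set Implicit Arguments.
Unset Strict Implicit.
Unset Printing Implicit Defensive.

Import Order.TTheory GRing.Theory Num.Theory.
Import numFieldNormedType.Exports.
Local Open Scope ring_scope.

Section Carpooling.
Variables (R : realType) (n : nat).

Record request := Request {
  fst_vertex : 'I_n;
  snd_vertex : 'I_n;
  weight : R }.

Definition valid_request (r : request) : Prop :=
  fst_vertex r <> snd_vertex r /\ 0 <= weight r <= 1.

Definition orient (d : 'rV[R]_n) (i j : 'I_n) (w : R) : 'rV[R]_n :=
  d + w *: (delta_mx 0 i - delta_mx 0 j).

(* Greedy raises the endpoint of smaller discrepancy; it is a relation because
   a tie satisfies both disjuncts, which leaves tie-breaking arbitrary, possibly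
   different at each step. *)
Definition greedy_step (d : 'rV[R]_n) (r : request) (d' : 'rV[R]_n) : Prop :=
  let i := fst_vertex r in let j := snd_vertex r in let w := weight r in
  (d 0 i <= d 0 j /\ d' = orient d i j w) \/
  (d 0 j <= d 0 i /\ d' = orient d j i w).

(* Requests are numbered from 1; only req 1, ..., req T and d 0, ..., d T
   are constrained. *)
Definition greedy_run (T : nat) (req : nat -> request)
    (d : nat -> 'rV[R]_n) : Prop :=
  d 0%N = 0 /\
  forall t : nat, (1 <= t <= T)%N -> greedy_step (d t.-1) (req t) (d t).

End Carpooling.

(* Main.v *)
Require Import Defs.
From HB Require Import structures.
From mathcomp Require Import all_boot all_order all_algebra.
From mathcomp Require Import all_classical all_reals all_analysis.
From mathcomp Require Import ring lra.
Set Implicit Arguments.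
Unset Strict Implicit.
Unset Printing Implicit Defensive.

Import Order.TTheory GRing.Theory Num.Theory.
Import numFieldNormedType.Exports.
Local Open Scope ring_scope.

(** Let S_A be the sum of the discrepancies over a vertex set A.  A greedy step
    moving weight w from j to i, with gap delta = d j - d i >= 0, can increase
    S_A only if i is in A and j is not, and then the new value S'_A satisfies
      2 S'_A = S_(A - i) + S_(A + j) - delta + 2w <= S_(A - i) + S_(A + j) + 2.
    Hence if S_A <= m c holds at all times for all A of size m, then the bound
    S_A <= k (m - k + c) for |A| = k <= m, whose second difference in k is -2,
    is preserved by Greedy; at k = 1 it reads d i <= m - 1 + c.
    Taking m = n and c = 0 gives the bound n.  For the other bound, a step
    increases the energy sum_i (d i)^2 by 2w(w - delta) <= 2, so by AM-GM
    S_A <= T / tau + |A| tau / 2, and m close to tau = T^(1/3), c = 3 tau / 2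
    are admissible.  Lower bounds follow because - d is also a greedy run. *)

Section Greedy.
Variables (R : realType) (n : nat).
Implicit Types (d : 'rV[R]_n) (A : {set 'I_n}).

Lemma orientE d (i j k : 'I_n) (w : R) :
  orient d i j w 0 k = d 0 k + w * ((k == i)%:R - (k == j)%:R).
Proof. by rewrite !mxE eqxx. Qed.

Lemma sum_orient d (i j : 'I_n) (w : R) A :
  \sum_(k in A) orient d i j w 0 k =
  \sum_(k in A) d 0 k + w * ((i \in A)%:R - (j \in A)%:R).
Proof.
have sum_eq (l : 'I_n) : \sum_(k in A) (k == l)%:R = (l \in A)%:R :> R.
  have [lA|/negP lA] := boolP (l \in A); last first.
    by rewrite big1// => k kA; case: eqP kA => // ->.
  rewrite (big_setD1 l)//= eqxx big1 ?addr0// => k.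
  by rewrite !inE => /andP[/negPf ->].
under eq_bigr do rewrite orientE.
by rewrite big_split -mulr_sumr sumrB !sum_eq.
Qed.

Lemma energy_orient d (i j : 'I_n) (w : R) : i != j ->
  \sum_k (orient d i j w 0 k) ^+ 2 =
  \sum_k (d 0 k) ^+ 2 + 2 * w * (w - (d 0 j - d 0 i)).
Proof.
move=> nij; rewrite (bigD1 i)//= (bigD1 j) 1?eq_sym//=.
rewrite [in RHS](bigD1 i)//= [in RHS](bigD1 j) 1?eq_sym//=.
rewrite (eq_bigr (fun k => (d 0 k) ^+ 2)); last first.
  by move=> k /andP[/negPf ki /negPf kj]; rewrite orientE ki kj subrr mulr0 addr0.
rewrite !orientE !eqxx (negPf nij) eq_sym (negPf nij) /=.
by ring.
Qed.

Lemma greedy_step_orient d d' (r : request R n) :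
  valid_request r -> greedy_step d r d' ->
  exists i j w, [/\ i != j, 0 <= w <= 1, d 0 i <= d 0 j & d' = orient d i j w].
Proof.
move=> [/eqP nij w01] [] [dij ->].
  by exists (fst_vertex r), (snd_vertex r), (weight r).
by exists (snd_vertex r), (fst_vertex r), (weight r); rewrite eq_sym.
Qed.

(** Negation reverses the order of the two endpoints and also swaps which of them is raised, so the
    two disjuncts trade places. *)
Lemma greedy_stepN d d' (r : request R n) :
  greedy_step d r d' -> greedy_step (- d) r (- d').
Proof.
have orientN i j w : - orient d i j w = orient (- d) j i w.
  by rewrite /orient opprD -scalerN opprB.
by move=> [] [dij ->]; [right | left]; rewrite orientN !mxE lerN2.
Qed.

Lemma greedy_runN T (req : nat -> request R n) (d : nat -> 'rV[R]_n) :
  greedy_run T req d -> greedy_run T req (fun t => - d t).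
Proof.
by move=> [d0 dS]; split=> [|t tT]; rewrite ?d0 ?oppr0//; apply/greedy_stepN/dS.
Qed.

Variables (T : nat) (req : nat -> request R n) (d : nat -> 'rV[R]_n).
Hypothesis req_valid : forall t, (1 <= t <= T)%N -> valid_request (req t).
Hypothesis d_greedy : greedy_run T req d.

(** Fixes [i] as the raised endpoint, once and for all. The step keeps [d t.+1] beside its equation,
    so that facts known along the whole run still apply to it. *)
Lemma greedy_run_ind (P : nat -> 'rV[R]_n -> Prop) :
  P 0%N 0 ->
  (forall t i j w, (t < T)%N -> i != j -> 0 <= w <= 1 ->
    d t 0 i <= d t 0 j -> d t.+1 = orient (d t) i j w ->
    P t (d t) -> P t.+1 (d t.+1)) ->
  forall t, (t <= T)%N -> P t (d t).
Proof.
move=> P0 PS; elim=> [_|t IH tT]; first by rewrite d_greedy.1.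
have := d_greedy.2 t.+1 tT => /(greedy_step_orient (req_valid (t := t.+1) tT)).
move=> [i [j [w [nij w01 dij dE]]]].
by apply: (PS _ i j w) => //; apply/IH/ltnW.
Qed.

Lemma greedy_sum0 t : (t <= T)%N -> \sum_k d t 0 k = 0.
Proof.
apply: (greedy_run_ind (P := fun _ x => \sum_k x 0 k = 0)) => [|s i j w].
  by rewrite big1// => k _; rewrite mxE.
move=> _ _ _ _ -> IH.
have := sum_orient (d s) i j w [set: 'I_n].
rewrite !finset.in_setT subrr mulr0 addr0.
rewrite (eq_bigl xpredT) => [->|k]; last by rewrite finset.in_setT.
by rewrite (eq_bigl xpredT)// => k; rewrite finset.in_setT.
Qed.

Lemma greedy_energy t : (t <= T)%N -> \sum_k (d t 0 k) ^+ 2 <= 2 * t%:R.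
Proof.
apply: (greedy_run_ind (P := fun s x => \sum_k (x 0 k) ^+ 2 <= 2 * s%:R)).
  by rewrite big1 ?mulr0// => k _; rewrite mxE expr0n.
move=> s i j w _ nij /andP[w0 w1] dij -> IH.
rewrite energy_orient// -natr1.
(* Dropping the gap term leaves an increase of at most [2 * w ^+ 2 <= 2]. *)
have : 0 <= w * (d s 0 j - d s 0 i) by rewrite mulr_ge0 ?subr_ge0.
by nra.
Qed.

Lemma greedy_sum_le (m : nat) (c : R) : 0 <= c ->
  (forall t A, (t <= T)%N -> #|A| = m -> \sum_(k in A) d t 0 k <= m%:R * c) ->
  forall t, (t <= T)%N -> forall A, (#|A| <= m)%N ->
    \sum_(k in A) d t 0 k <= #|A|%:R * (m%:R - #|A|%:R + c).
Proof.
move=> c0 sum_m.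
apply: (greedy_run_ind (P := fun _ x => forall A, (#|A| <= m)%N ->
    \sum_(k in A) x 0 k <= #|A|%:R * (m%:R - #|A|%:R + c))) => [A Am|].
  rewrite big1 => [|k _]; last by rewrite mxE.
  by rewrite mulr_ge0// addr_ge0// subr_ge0 ler_nat.
move=> t i j w tT nij /andP[w0 w1] dij dE IH A Am.
(* At size [m] the hypothesis applies at the new time; below it, [j |: A] still has size at most
   [m]. *)
have [Am'|Am'] := eqVneq #|A| m.
  by rewrite Am' subrr add0r; apply: sum_m.
have {Am'} Altm : (#|A| < m)%N by rewrite ltn_neqAle Am'.
rewrite dE sum_orient.
have [iA|iA] := boolP (i \in A); last first.
  have := IH A Am; case: (j \in A) => /= IHA; nra.
have [jA|jA] := boolP (j \in A); first by rewrite subrr mulr0 addr0 IH.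
(* The bounds at sizes [#|A| - 1] and [#|A| + 1] average to the bound at [#|A|] minus 1, which
   absorbs [w <= 1]. *)
have := IH (j |: A); have := IH (A :\ i)%SET.
have := cardsU1 j A; rewrite jA /= => ->.
have := cardsD1 i A; rewrite iA /=; set b := #|(A :\ i)%SET| => Ab.
rewrite big_setU1//= !(big_setD1 i iA)/=.
rewrite Ab in Altm *; move=> /(_ (ltnW (ltnW Altm))) IHi /(_ Altm) IHj.
move: IHi IHj; rewrite !natrD.
by nra.
Qed.

Lemma greedy_coord_le (m : nat) (c : R) : (0 < m)%N -> 0 <= c ->
  (forall t A, (t <= T)%N -> #|A| = m -> \sum_(k in A) d t 0 k <= m%:R * c) ->
  forall t i, (t <= T)%N -> d t 0 i <= m%:R - 1 + c.
Proof.
move=> m0 c0 sum_m t i tT.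
have := greedy_sum_le c0 sum_m tT (A := [set i]%SET).
by rewrite cards1 big_set1 mul1r; apply.
Qed.

Lemma greedy_coord_le_n t i : (0 < n)%N -> (t <= T)%N -> d t 0 i <= n%:R.
Proof.
move=> n0 tT; apply: (@le_trans _ _ (n%:R - 1 + 0)); last by lra.
apply: greedy_coord_le => // s A sT An.
(* The only set of size [n] is the full one, over which the discrepancies cancel. *)
have -> : A = [set: 'I_n]%SET.
  by apply/eqP; rewrite eqEcard finset.subsetT cardsT card_ord An /=.
rewrite mulr0 (eq_bigl xpredT) ?greedy_sum0// => k.
by rewrite finset.in_setT.
Qed.

Lemma greedy_coord_le_cbrt t i : (0 < T)%N -> (t <= T)%N ->
  d t 0 i <= 3 * T%:R `^ 3^-1.
Proof.
move=> T0 tT; set tau := T%:R `^ 3^-1.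
have tau0 : 0 < tau by apply: powR_gt0; rewrite ltr0n.
have tau3 : tau ^+ 3 = T%:R.
  by rewrite -powR_mulrn ?ltW// -powRrM mulVf ?powRr1 ?pnatr_eq0.
have /andP[mtau taum] := truncn_itv (ltW tau0).
(* Thus [m - 1 <= tau < m]: the first inequality gives [m - 1 + 3 / 2 * tau <= 3 * tau], the second
   [tau ^+ 2 + m * tau / 2 <= m * (3 / 2 * tau)]. *)
set m := (Num.truncn tau).+1 in taum.
apply: (@le_trans _ _ (m%:R - 1 + 3 / 2 * tau)); last first.
  by rewrite /m -natr1; lra.
apply: greedy_coord_le => // [|s A sT Am]; first by lra.
have sum_le : \sum_(k in A) d s 0 k <=
    (2 * tau)^-1 * \sum_(k in A) (d s 0 k) ^+ 2 + m%:R * (tau / 2).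
  rewrite -Am [X in _ + X]mulr_natl -sumr_const mulr_sumr -big_split /=.
  apply: ler_sum => k _; rewrite -subr_ge0.
  have -> : (2 * tau)^-1 * d s 0 k ^+ 2 + tau / 2 - d s 0 k =
      (2 * tau)^-1 * (d s 0 k - tau) ^+ 2 by field; lra.
  by rewrite mulr_ge0 ?sqr_ge0 ?invr_ge0 ?mulr_ge0 ?ltW.
have energy_le : \sum_(k in A) (d s 0 k) ^+ 2 <= 2 * tau ^+ 3.
  apply: (@le_trans _ _ (\sum_k (d s 0 k) ^+ 2)).
    rewrite [leRHS](bigID (mem A))/= lerDl sumr_ge0// => k _.
    exact: sqr_ge0.
  by rewrite (le_trans (greedy_energy sT))// tau3 ler_pM2l// ler_nat.
have : (2 * tau)^-1 * \sum_(k in A) (d s 0 k) ^+ 2 <= tau ^+ 2.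
  rewrite (@le_trans _ _ ((2 * tau)^-1 * (2 * tau ^+ 3)))//.
    by rewrite ler_wpM2l// invr_ge0 mulr_ge0// ltW.
  by rewrite le_eqVlt; apply/orP; left; apply/eqP; field; lra.
by nra.
Qed.

End Greedy.

Theorem theorem1p1 (R : realType) :
  exists C : R, 0 < C /\
    forall (n T : nat) (req : nat -> request R n) (d : nat -> 'rV[R]_n),
      (2 <= n)%N -> (1 <= T)%N ->
      (forall t : nat, (1 <= t <= T)%N -> valid_request (req t)) ->
      greedy_run T req d ->
      \big[Num.max/0]_(t < T.+1) `|d t|
        <= C * Num.min (T%:R `^ 3^-1) n%:R.
Proof.
exists 3; split=> // n T req d n2 T1 req_valid d_greedy.
(* Needed for the default value 0 of both maxima, over times and over matrix entries. *)
have bound_ge0 : 0 <= 3 * Num.min (T%:R `^ 3^-1) n%:R :> R.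
  by rewrite mulr_ge0// le_min powR_ge0 ler0n.
(* Stated for any run [e], to be used with both [d] and its negation. *)
have coord_le (e : nat -> 'rV[R]_n) t i : greedy_run T req e -> (t <= T)%N ->
    e t 0 i <= 3 * Num.min (T%:R `^ 3^-1) n%:R.
  move=> e_greedy tT; rewrite minr_pMr// le_min.
  rewrite (greedy_coord_le_cbrt req_valid e_greedy)//=.
  rewrite (le_trans (greedy_coord_le_n req_valid e_greedy i (ltnW n2) tT))//.
  by rewrite ler_peMl// ler1n.
apply: bigmax_le => // t _.
rewrite [leLHS]mx_normrE; apply: bigmax_le => // -[k i] _ /=.
have tT : (t <= T)%N by rewrite -ltnS.
rewrite ord1 ler_norml; apply/andP; split; last exact: coord_le d_greedy tT.
by have := coord_le _ t i (greedy_runN d_greedy) tT; rewrite mxE lerNl.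
Qed.
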